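(* The node time complexity and the branch time complexity of algorithm lmaxRPC3$^{rm}$ are both $O(end^4)$, and the node time complexity and the branch time complexity of algorithm maxRPC3$^{rm}$ are both $O(en^2d^4)$, where $n$ is the number of variables, $e$ the number of constraints and $d$ the maximum domain size of the binary CSP.
   Context: **Problem.** A binary CSP consists of variables $X=\{x_1,\dots,x_n\}$, finite domains $D(x_1),\dots,D(x_n)$ of size at most $d$, and a set $C$ of $e$ binary constraints; the constraint on $\{x_i,x_j\}$, if present, is denoted $c_{ij}$ (also $c_{ji}$) and specifies the allowed pairs of values. $D(x_i)$ always denotes the current domain. Each initial domain is totally ordered (lexicographic order); iteration over a domain is in this order. isConsistent$(a_i,a_j)$ tests whether $(a_i,a_j)$ is allowed by $c_{ij}$; one such test is a constraint check and takes constant time. An AC-support of $a_i$ in $D(x_j)$ is an $a_j\in D(x_j)$ such that $(a_i,a_j)$ satisfies $c_{ij}$. It is a PC-support if moreover for every third variable $x_k$ there is $a_k\in D(x_k)$ (a PC-witness) that is an AC-support of both $a_i$ and $a_j$. A value is maxRPC iff it has an AC-support, which is also a PC-support, in $D(x_j)$ for each constraint $c_{ij}$. **Complexity measures.** Time complexities give the asymptotic number of constraint checks. The node time complexity of an algorithm is the worst-case time complexity of invoking it after a variable assignment. The branch time complexity is the worst-case total time complexity of any incremental sequence of $k\le n$ invocations, i.e. of incrementally running the algorithm down a branch of the search tree until a fail occurs. **Data structures.** For each constraint $c_{ij}$ and $a_i\in D(x_i)$ there are pointers $LastPC_{x_i,a_i,x_j}$ and $LastAC_{x_i,a_i,x_j}$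 to the most recently discovered PC-support, resp. AC-support, of $a_i$ in $D(x_j)$; initially all are NIL (not a member of any domain). They are used as residues: they are simply kept during search and are not restored upon backtracking. $L$ is a list (set) of variables. **Invocation after an assignment.** $L$ is initialized with the currently assigned variable (whose domain is reduced to the assigned value). **maxRPC3$^{rm}$ (main loop).** While $L\ne\emptyset$: remove some $x_j$ from $L$. For each $x_i$ with $c_{ij}\in C$: for each $a_i\in D(x_i)$: if searchPCsup$(a_i,x_j)$ is false, delete $a_i$ and add $x_i$ to $L$; otherwise, if checkPCwit$(a_i,x_j)$ is false, delete $a_i$ and add $x_i$ to $L$. After processing the values of $x_i$, if $D(x_i)=\emptyset$ return FAILURE. When $L=\emptyset$ return SUCCESS. **lmaxRPC3$^{rm}$** (the light version) is obtained from maxRPC3$^{rm}$ by omitting the call to checkPCwit (and the deletion depending on it) in the main loop. **searchPCsup$(a_i,x_j)$.** If $LastPC_{x_i,a_i,x_j}\in D(x_j)$ return true. Otherwise, for each $a_j\in D(x_j)$ from the first value on: if isConsistent$(a_i,a_j)$ and searchPCwit$(a_i,a_j)$, set $LastPC_{x_i,a_i,x_j}=a_j$, $LastAC_{x_i,a_i,x_j}=a_j$, $LastPC_{x_j,a_j,x_i}=a_i$, and return true. Return false. **searchPCwit$(a_i,a_j)$.** For each $x_k$ with $c_{ik},c_{jk}\in C$: if ($LastAC_{x_i,a_i,x_k}\in D(x_k)$ and isConsistent$(LastAC_{x_i,a_i,x_k},a_j)$) or ($LastAC_{x_j,a_j,x_k}\in D(x_k)$ and isConsistent$(LastAC_{x_j,a_j,x_k},a_i)$),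 continue with the next $x_k$. Otherwise search $D(x_k)$ from its first value for an $a_k$ with isConsistent$(a_i,a_k)$ and isConsistent$(a_j,a_k)$; if one is found set $LastAC_{x_i,a_i,x_k}=LastAC_{x_j,a_j,x_k}=a_k$, otherwise return false. Return true after all $x_k$. **checkPCwit$(a_i,x_j)$.** For each $x_k$ with $c_{ik},c_{kj}\in C$: set witness = false. (First part) If $a_k:=LastPC_{x_i,a_i,x_k}\in D(x_k)$: if ($LastAC_{x_i,a_i,x_j}\in D(x_j)$ and isConsistent$(LastAC_{x_i,a_i,x_j},a_k)$) or ($LastAC_{x_k,a_k,x_j}\in D(x_j)$ and isConsistent$(LastAC_{x_k,a_k,x_j},a_i)$), set witness = true; otherwise search $D(x_j)$ from its first value for an $a_j$ consistent with both $a_i$ and $a_k$, and if one is found set $LastAC_{x_i,a_i,x_j}=LastAC_{x_k,a_k,x_j}=a_j$ and witness = true. (Second part) If witness is false: for each $a_k\in D(x_k)$ from the first value on, if isConsistent$(a_i,a_k)$ and searchPCwit$(a_i,a_k)$, set $LastPC_{x_i,a_i,x_k}=a_k$, $LastAC_{x_i,a_i,x_k}=a_k$, $LastPC_{x_k,a_k,x_i}=a_i$, witness = true, and stop this search. If witness is still false return false. Return true after all $x_k$. *)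

(* Defs.v *)
From mathcomp Require Import all_boot.

Set Implicit Arguments.
Unset Strict Implicit.
Unset Printing Implicit Defensive.

(* A binary CSP on n variables.  The list [dom i] carries the total order of
   the initial domain of variable i; [allowed i j] is only meaningful when
   there is a constraint between i and j. *)
Record csp (n : nat) := Csp {
  value : eqType;
  dom : 'I_n -> seq value;
  dom_uniq : forall i, uniq (dom i);
  con : rel 'I_n;
  con_irrefl : irreflexive con;
  con_sym : symmetric con;
  allowed : 'I_n -> 'I_n -> rel value;
  allowed_sym : forall i j a b, con i j -> allowed i j a b = allowed j i b a
}.

Arguments allowed [n] c i j _ _.

Definition num_constraints n (P : csp n) : nat :=
  #|[set p : 'I_n * 'I_n | (p.1 < p.2) && con P p.1 p.2]|.

Definition max_domain_size n (P : csp n) : nat := \max_(i < n) size (dom P i).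

Variant algorithm := lmaxRPC3rm | maxRPC3rm.

Variant status := Running | Failure.

Section Algorithms.

Context (n : nat) (P : csp n).

Local Notation var := 'I_n.
Local Notation val := (value P).

(* [lastPC s (i, a, j)] and [lastAC s (i, a, j)] are the pointers LastPC and
   LastAC of the value a of variable i in the domain of variable j, with None
   for NIL; [doms s] are the current domains and [queue s] is the list L. *)
Record state := State {
  doms : var -> seq val;
  lastPC : var * val * var -> option val;
  lastAC : var * val * var -> option val;
  queue : {set var}
}.

Definition with_doms (s : state) D := State D (lastPC s) (lastAC s) (queue s).
Definition with_lastPC (s : state) p := State (doms s) p (lastAC s) (queue s).
Definition with_lastAC (s : state) p := State (doms s) (lastPC s) p (queue s).
Definition with_queue (s : state) L := State (doms s) (lastPC s) (lastAC s) L.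

(* [c s r t s'] means that c, started in s, can end in s' with result r after
   t constraint checks.  It is a relation because the order in which variables
   are enumerated is not prescribed by the algorithms. *)
Definition cmd (A : Type) := state -> A -> nat -> state -> Prop.

Definition ret A (x : A) : cmd A :=
  fun s r t s' => [/\ r = x, t = 0 & s' = s].

Definition bind A B (m : cmd A) (f : A -> cmd B) : cmd B :=
  fun s r t s' => exists x t1 s1 t2,
    [/\ m s x t1 s1, f x s1 r t2 s' & t = t1 + t2].

Local Notation "'let*' x ':=' m 'in' f" := (bind m (fun x => f))
  (at level 200, x name, m at level 100, f at level 200).

Definition get : cmd state := fun s r t s' => [/\ r = s, t = 0 & s' = s].

Definition update (f : state -> state) : cmd unit :=
  fun s _ t s' => t = 0 /\ s' = f s.

(* isConsistent: the only command that is charged for. *)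
Definition isConsistent (i : var) (a : val) (j : var) (b : val) : cmd bool :=
  fun s r t s' => [/\ r = allowed P i j a b, t = 1 & s' = s].

Definition vars_in_any_order (p : pred var) : cmd (seq var) :=
  fun s r t s' => [/\ perm_eq r (enum p), t = 0 & s' = s].

(* Lazy conjunction and disjunction. *)
Definition and_cmd (m1 m2 : cmd bool) : cmd bool :=
  let* b := m1 in if b then m2 else ret false.
Definition or_cmd (m1 m2 : cmd bool) : cmd bool :=
  let* b := m1 in if b then ret true else m2.

(* Loops that stop at the first success, resp. at the first failure. *)
Definition some_of A (l : seq A) (f : A -> cmd bool) : cmd bool :=
  foldr (fun x m => or_cmd (f x) m) (ret false) l.
Definition all_of A (l : seq A) (f : A -> cmd bool) : cmd bool :=
  foldr (fun x m => and_cmd (f x) m) (ret true) l.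
Definition for_each A (l : seq A) (f : A -> cmd unit) : cmd unit :=
  foldr (fun x m => let* _ := f x in m) (ret tt) l.

(* The value pointed to, provided it is in the current domain of variable k. *)
Definition residue (s : state) (k : var) (o : option val) : option val :=
  if o is Some c then if c \in doms s k then Some c else None else None.

Definition try_lastAC (i : var) (a : val) (k : var) (j : var) (b : val) :
    cmd bool :=
  let* s := get in
  if residue s k (lastAC s (i, a, k)) is Some c then isConsistent k c j b
  else ret false.

(* Look for a PC-witness, in the domain of k, of the pair made of the value a
   of i and the value b of j. *)
Definition find_PCwit (i : var) (a : val) (j : var) (b : val) (k : var) :
    cmd bool :=
  or_cmd (try_lastAC i a k j b)
    (or_cmd (try_lastAC j b k i a)
      (let* s := get in
       some_of (doms s k) (fun c =>
         and_cmd (isConsistent i a k c)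
           (and_cmd (isConsistent j b k c)
             (let* _ := update (fun s' => with_lastAC s'
                [eta lastAC s' with (i, a, k) |-> Some c,
                                    (j, b, k) |-> Some c]) in
              ret true))))).

Definition searchPCwit (i : var) (a : val) (j : var) (b : val) : cmd bool :=
  let* ks := vars_in_any_order [pred k | con P i k && con P j k] in
  all_of ks (fun k => find_PCwit i a j b k).

(* Look for a PC-support of the value a of i by scanning the domain of j. *)
Definition scan_PCsup (i : var) (a : val) (j : var) : cmd bool :=
  let* s := get in
  some_of (doms s j) (fun b =>
    and_cmd (isConsistent i a j b)
      (and_cmd (searchPCwit i a j b)
        (let* _ := update (fun s' =>
           with_lastPC
             (with_lastAC s' [eta lastAC s' with (i, a, j) |-> Some b])
             [eta lastPC s' with (i, a, j) |-> Some b,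
                                 (j, b, i) |-> Some a]) in
         ret true))).

Definition searchPCsup (i : var) (a : val) (j : var) : cmd bool :=
  let* s := get in
  if residue s j (lastPC s (i, a, j)) is Some _ then ret true
  else scan_PCsup i a j.

Definition checkPCwit (i : var) (a : val) (j : var) : cmd bool :=
  let* ks := vars_in_any_order [pred k | con P i k && con P k j] in
  all_of ks (fun k =>
    or_cmd
      (let* s := get in
       if residue s k (lastPC s (i, a, k)) is Some c then find_PCwit i a k c j
       else ret false)
      (scan_PCsup i a k)).

Definition delete (i : var) (a : val) : cmd unit :=
  update (fun s => with_queue
    (with_doms s [eta doms s with i |-> [seq b <- doms s i | b != a]])
    (i |: queue s)).

Definition revise_value (alg : algorithm) (j i : var) (a : val) : cmd unit :=
  let* b := (match alg with
             | lmaxRPC3rm => searchPCsup i a j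
             | maxRPC3rm => and_cmd (searchPCsup i a j) (checkPCwit i a j)
             end) in
  if b then ret tt else delete i a.

(* One iteration of the main loop, for a variable j just removed from L; the
   result false stands for the return of FAILURE. *)
Definition process (alg : algorithm) (j : var) : cmd bool :=
  let* ns := vars_in_any_order (con P j) in
  all_of ns (fun i =>
    let* s := get in
    let* _ := for_each (doms s i) (revise_value alg j i) in
    let* s' := get in
    ret (doms s' i != [::])).

(* [reaches alg s0 st t s]: t constraint checks are made by the iterations of
   the main loop that lead from s0 to s.  No completion is required, so that
   a bound on all such t also bounds the checks of a non-terminating run. *)
Inductive reaches (alg : algorithm) (s0 : state) :
    status -> nat -> state -> Prop :=
| reaches_start : reaches alg s0 Running 0 s0
| reaches_iter t s j r t' s' :
    reaches alg s0 Running t s -> j \in queue s ->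
    process alg j (with_queue s (queue s :\ j)) r t' s' ->
    reaches alg s0 (if r then Running else Failure) (t + t') s'.

Definition succeeds alg (s0 : state) t (s : state) : Prop :=
  reaches alg s0 Running t s /\ queue s = set0.

Definition fails alg (s0 : state) t (s : state) : Prop :=
  reaches alg s0 Failure t s.

Definition assign (s : state) (x : var) (a : val) : state :=
  with_queue (with_doms s [eta doms s with x |-> [:: a]]) [set x].

Definition initial_state : state :=
  State (dom P) (fun=> None) (fun=> None) set0.

(* The states in which the algorithm can be invoked during search.  Residues
   are NIL at first and from then on only changed by the algorithm.  The third
   rule covers backtracking: it may restore any current domains, possibly
   without refuted values, whatever the search strategy; the residues stay. *)
Inductive search_state (alg : algorithm) : state -> Prop :=
| search_initial : search_state alg initial_state
| search_assign s x a t s' :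
    search_state alg s -> a \in doms s x ->
    succeeds alg (assign s x a) t s' \/ fails alg (assign s x a) t s' ->
    search_state alg s'
| search_backtrack s D :
    search_state alg s -> (forall i, subseq (D i) (dom P i)) ->
    search_state alg (with_doms s D).

(* [branch alg s0 A t s]: starting from s0, the variables of A are assigned
   one after the other, each assignment being followed by a successful
   invocation, with t constraint checks in total. *)
Inductive branch (alg : algorithm) (s0 : state) :
    {set var} -> nat -> state -> Prop :=
| branch_start : branch alg s0 set0 0 s0
| branch_assign A t s x a t' s' :
    branch alg s0 A t s -> x \notin A -> a \in doms s x ->
    succeeds alg (assign s x a) t' s' ->
    branch alg s0 (x |: A) (t + t') s'.

Definition node_checks (alg : algorithm) (t : nat) : Prop :=
  exists s x a st s',
    [/\ search_state alg s, a \in doms s x &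
        reaches alg (assign s x a) st t s'].

(* Only the last invocation of the sequence may fail or be incomplete.  The
   sequence has length #|A|.+1 <= n because x is not in A. *)
Definition branch_checks (alg : algorithm) (t : nat) : Prop :=
  exists s0 A t1 s x a st t2 s',
    [/\ search_state alg s0, branch alg s0 A t1 s,
        x \notin A /\ a \in doms s x,
        reaches alg (assign s x a) st t2 s' & t = t1 + t2].

End Algorithms.

(* [T n e d t] should hold when t is the cost of an execution on some input of
   size (n, e, d): its worst-case cost is then O(f). *)
Definition worst_case_bigO (T : nat -> nat -> nat -> nat -> Prop)
    (f : nat -> nat -> nat -> nat) : Prop :=
  exists K : nat, forall n e d t, T n e d t -> t <= K * f n e d.

Definition node_time (alg : algorithm) (n e d t : nat) : Prop :=
  exists P : csp n,
    [/\ num_constraints P = e, max_domain_size P = d & node_checks P alg t].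

Definition branch_time (alg : algorithm) (n e d t : nat) : Prop :=
  exists P : csp n,
    [/\ num_constraints P = e, max_domain_size P = d & branch_checks P alg t].

(* Main.v *)
Require Import Defs.
From mathcomp Require Import all_boot.
From mathcomp Require Import zify.

(** Residues are never needed for the bounds.  A variable j enters the queue
    only when it is assigned or when its domain loses a value, so [j is queued]
    + |D(j)| + [j is not yet assigned] never increases along a branch and drops
    each time j is taken from the queue: j is processed O(d) times.  Processing
    j revises at most d values of each neighbour of j, hence there are O(e d^2)
    revisions, as the degrees sum to 2e.  A revision scans a domain for a
    PC-support in O(n d^2) checks, and maxRPC3rm repeats such a scan for each of
    at most n third variables. *)

Set Implicit Arguments.
Unset Strict Implicit.
Unset Printing Implicit Defensive.

Section Within.

Context (n : nat) (P : csp n).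

Local Notation var := 'I_n.
Local Notation val := (value P).
Local Notation state := (state P).
Local Notation d := (max_domain_size P).

(** * Valid states and a calculus of cost bounds for commands *)

Definition valid (s : state) : Prop := forall i, subseq (doms s i) (dom P i).

Lemma size_doms s i : valid s -> size (doms s i) <= d.
Proof.
move=> s_valid; apply: leq_trans (size_subseq (s_valid i)) _.
exact: (leq_bigmax (F := fun i => size (dom P i))).
Qed.

Lemma uniq_doms s i : valid s -> uniq (doms s i).
Proof. by move=> s_valid; apply: subseq_uniq (s_valid i) (dom_uniq P i). Qed.

(** The relation [R] travels with the cost because the next command is bounded only from a valid
    state. It is [same_domains] for the searches and [shrinks] for an iteration of the main loop. *)
Record within (R : state -> state -> Prop) A (m : cmd P A) (c : nat) : Prop :=
  Within { within_run :>
    forall s r t s', valid s -> m s r t s' -> t <= c /\ R s s' }.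

(** What sequencing takes: reflexivity for commands without effect, transitivity for composition,
    validity to start the second command. *)
Record valid_preorder (R : state -> state -> Prop) : Prop := ValidPreorder {
  preorder_refl : forall s, R s s;
  preorder_trans : forall s1 s2 s3, R s1 s2 -> R s2 s3 -> R s1 s3;
  preorder_valid : forall s s', R s s' -> valid s -> valid s'
}.

Section Relation.

Context (R : state -> state -> Prop) (HR : valid_preorder R).

Lemma within_leq A (m : cmd P A) c c' :
  within R m c -> c <= c' -> within R m c'.
Proof.
move=> Hm le_cc'; split=> s r t s' s_valid m_s.
have [le_tc Rss'] := Hm _ _ _ _ s_valid m_s.
by split; first exact: leq_trans le_cc'.
Qed.

Lemma within_ret A (x : A) : within R (ret x) 0.
Proof. by split=> s r t s' _ [_ -> ->]; split=> //; apply: preorder_refl. Qed.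

Lemma within_isConsistent i a j b : within R (isConsistent (P := P) i a j b) 1.
Proof. by split=> s r t s' _ [_ -> ->]; split=> //; apply: preorder_refl. Qed.

Lemma within_bind A B (m : cmd P A) (f : A -> cmd P B) c c' :
  within R m c -> (forall x, within R (f x) c') -> within R (bind m f) (c + c').
Proof.
move=> Hm Hf; split=> s r t s' s_valid [x [t1 [s1 [t2 [m1 m2 ->]]]]].
have [le1 R1] := Hm _ _ _ _ s_valid m1.
have [le2 R2] := Hf _ _ _ _ _ (preorder_valid HR R1 s_valid) m2.
by split; [exact: leq_add | exact: (preorder_trans HR R1 R2)].
Qed.

(** Unlike in [within_bind], the continuation may use that the state just read is valid, which
    bounds the length of a loop over one of its domains. *)
Lemma within_get A (f : state -> cmd P A) c :
  (forall s, valid s -> within R (f s) c) -> within R (bind (@get _ P) f) c.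
Proof.
move=> Hf; split=> s r t s' s_valid [x [t1 [s1 [t2 [[-> -> ->] m2 ->]]]]].
exact: (Hf s s_valid _ _ _ _ s_valid m2).
Qed.

Lemma within_vars A (p : pred var) (f : seq var -> cmd P A) c :
  (forall ks, size ks = #|p| -> within R (f ks) c) ->
  within R (bind (@vars_in_any_order _ P p) f) c.
Proof.
move=> Hf; split=> s r t s' s_valid [ks [t1 [s1 [t2 [[ks_p -> ->] m2 ->]]]]].
by apply: (Hf ks) m2 => //; rewrite (perm_size ks_p) -cardE.
Qed.

Lemma within_and m1 m2 c1 c2 :
  within R m1 c1 -> within R m2 c2 -> within R (and_cmd m1 m2) (c1 + c2).
Proof.
move=> H1 H2; apply: within_bind => // - [] //=.
exact: within_leq (within_ret _) _.
Qed.

Lemma within_or m1 m2 c1 c2 :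
  within R m1 c1 -> within R m2 c2 -> within R (or_cmd m1 m2) (c1 + c2).
Proof.
move=> H1 H2; apply: within_bind => // - [] //=.
exact: within_leq (within_ret _) _.
Qed.

Lemma within_all_of A (l : seq A) f c :
  (forall x, within R (f x) c) -> within R (all_of l f) (size l * c).
Proof.
move=> Hf; elim: l => [|x l IHl] /=; first exact: within_ret.
by rewrite mulSn; apply: within_and.
Qed.

Lemma within_some_of A (l : seq A) f c :
  (forall x, within R (f x) c) -> within R (some_of l f) (size l * c).
Proof.
move=> Hf; elim: l => [|x l IHl] /=; first exact: within_ret.
by rewrite mulSn; apply: within_or.
Qed.

Lemma within_all_vars (p : pred var) f c :
  (forall k, within R (f k) c) ->
  within R (bind (@vars_in_any_order _ P p) (fun ks => all_of ks f)) (#|p| * c).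
Proof. by move=> Hf; apply: within_vars => ks <-; apply: within_all_of. Qed.

Lemma within_some_value i f c :
  (forall b, within R (f b) c) ->
  within R (bind (@get _ P) (fun s => some_of (doms s i) f)) (d * c).
Proof.
move=> Hf; apply: within_get => s s_valid.
apply: within_leq (within_some_of _ Hf) _.
by rewrite leq_mul2r size_doms ?orbT.
Qed.

End Relation.

(** * Cost of the searches for supports and witnesses *)

Definition same_domains (s s' : state) : Prop :=
  doms s' = doms s /\ queue s' = queue s.

Lemma same_domains_preorder : valid_preorder same_domains.
Proof.
split=> [//|s1 s2 s3 [D12 Q12] [D23 Q23]|s s' [D _] s_valid i].
  by split; rewrite ?D23 ?Q23.
by rewrite D.
Qed.

Hint Resolve same_domains_preorder : core.

Local Notation search_within := (within same_domains).

Lemma within_update_pointers f :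
  (forall s, same_domains s (f s)) ->
  search_within (bind (@update _ P f) (fun=> ret true)) 0.
Proof.
move=> Hf; apply: (@within_bind _ same_domains_preorder _ _ _ _ 0 0).
  by split=> s r t s' _ [-> ->].
by move=> _; apply: within_ret.
Qed.

Lemma within_try_lastAC i a k j b :
  search_within (@try_lastAC _ P i a k j b) 1.
Proof.
apply: within_get => s _; case: residue => [c|]; first exact: within_isConsistent.
exact: within_leq (within_ret _ _) _.
Qed.

Lemma within_find_PCwit i a j b k :
  search_within (@find_PCwit _ P i a j b k) (2 + 2 * d).
Proof.
(* One check for each of the two residues, then at most [d] values with two checks each and a free
   update. *)
rewrite (_ : 2 + 2 * d = 1 + (1 + d * (1 + (1 + 0)))); last by lia.
do 2![apply: within_or => //; first exact: within_try_lastAC].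
apply: within_some_value => // c.
do 2![apply: within_and => //; first exact: within_isConsistent].
exact: within_update_pointers.
Qed.

Lemma within_searchPCwit i a j b :
  search_within (@searchPCwit _ P i a j b) (n * (2 + 2 * d)).
Proof.
apply: within_leq (within_all_vars _ _ (within_find_PCwit i a j b)) _ => //.
by rewrite leq_mul2r -[X in _ <= X]card_ord max_card orbT.
Qed.

(** Each of at most [d] values takes one check and a witness search over at most [n] third
    variables. *)
Definition scan_cost : nat := d * (1 + n * (2 + 2 * d)).

Lemma within_scan_PCsup i a j :
  search_within (@scan_PCsup _ P i a j) scan_cost.
Proof.
rewrite /scan_cost -[n * _]addn0; apply: within_some_value => // b.
apply: within_and => //; first exact: within_isConsistent.
apply: within_and => //; first exact: within_searchPCwit.
exact: within_update_pointers.
Qed.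

Lemma within_searchPCsup i a j :
  search_within (@searchPCsup _ P i a j) scan_cost.
Proof.
apply: within_get => s _; case: residue => [c|]; last exact: within_scan_PCsup.
exact: within_leq (within_ret _ _) _.
Qed.

(** For each third variable, the witness search from the residue may fail and be followed by a full
    scan. *)
Lemma within_checkPCwit i a j :
  search_within (@checkPCwit _ P i a j) (n * (2 + 2 * d + scan_cost)).
Proof.
apply: (within_leq (c := #|[pred k | con P i k && con P k j]| * _)).
  apply: within_all_vars => // k.
  apply: within_or => //; last exact: within_scan_PCsup.
  apply: within_get => s _; case: residue => [c|]; first exact: within_find_PCwit.
  exact: within_leq (within_ret _ _) _.
by rewrite leq_mul2r -[X in _ <= X]card_ord max_card orbT.
Qed.

(** * Cost and weights in one iteration of the main loop *)

Definition search_cost (alg : algorithm) : nat :=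
  match alg with
  | lmaxRPC3rm => scan_cost
  | maxRPC3rm => scan_cost + n * (2 + 2 * d + scan_cost)
  end.

(** During an iteration a variable joins the queue only when it loses a value, so the first summand
    can grow only at the expense of the second. *)
Definition weight (s : state) (j : var) : nat :=
  (j \in queue s) + size (doms s j).

Definition shrinks (s s' : state) : Prop :=
  forall j, subseq (doms s' j) (doms s j) /\ weight s' j <= weight s j.

Lemma shrinks_preorder : valid_preorder shrinks.
Proof.
split=> [//|s1 s2 s3 H12 H23 j|s s' H s_valid j].
  have [[D12 W12] [D23 W23]] := (H12 j, H23 j).
  by split; [exact: subseq_trans D12 | exact: leq_trans W12].
by have [D _] := H j; apply: subseq_trans (s_valid j).
Qed.

Hint Resolve shrinks_preorder : core.

Lemma same_domains_shrinks s s' : same_domains s s' -> shrinks s s'.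
Proof. by move=> [D Q] j; rewrite /weight D Q. Qed.

(** As [a] is present, deleting it lowers the size by at least one, which pays for [i] joining the
    queue. *)
Lemma delete_shrinks i a s r t s' :
  a \in doms s i -> delete i a s r t s' -> t = 0 /\ shrinks s s'.
Proof.
move=> a_i [-> ->]; split=> // j; rewrite /weight /= !inE.
case: (eqVneq j i) => [->|//]; split; first exact: filter_subseq.
have : has (pred1 a) (doms s i) by rewrite has_pred1.
rewrite has_count size_filter -(count_predC (pred1 a) (doms s i)) orTb.
rewrite -[count (fun b => b != a) _]/(count (predC (pred1 a)) _).
by move: (count (pred1 a) _) (count (predC _) _) => c c' /=; lia.
Qed.

(** The last clause serves the loop over a domain read in advance: a value whose turn is still to
    come must be present, as [delete_shrinks] asks. *)
Lemma revise_value_spec alg j i a s r t s' :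
  valid s -> a \in doms s i -> revise_value alg j i a s r t s' ->
  [/\ t <= search_cost alg, shrinks s s' &
      forall b, b != a -> b \in doms s i -> b \in doms s' i].
Proof.
move=> s_valid a_i [b [t1 [s1 [t2 [m1 m2 ->]]]]].
have search_ok : search_within
    (match alg with
     | lmaxRPC3rm => searchPCsup (P := P) i a j
     | maxRPC3rm => and_cmd (searchPCsup (P := P) i a j) (checkPCwit i a j)
     end) (search_cost alg).
  case: alg {m1}; first exact: within_searchPCsup.
  apply: within_and => //; first exact: within_searchPCsup.
  exact: within_checkPCwit.
have [le1 same1] := search_ok _ _ _ _ s_valid m1.
have [D1 _] := same1; case: b m2 {m1} => [[_ -> ->]|m2].
  by split; rewrite ?addn0 ?D1 //; apply: same_domains_shrinks.
(* The search has changed pointers only, so the value is still there to be deleted. *)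
have a_i1 : a \in doms s1 i by rewrite D1.
have [t2_0 sh2] := delete_shrinks a_i1 m2; split.
- by rewrite t2_0 addn0.
- exact: (preorder_trans shrinks_preorder (same_domains_shrinks same1) sh2).
- by move: m2 => [_ ->] b b_a b_i; rewrite /= eqxx mem_filter b_a D1.
Qed.

(** Deletions change the domain while [l] stays fixed; since [l] has no repetitions, a deleted value
    never comes up again. *)
Lemma for_each_revise_value alg j i l s r t s' :
  valid s -> uniq l -> {subset l <= doms s i} ->
  for_each l (revise_value alg j i) s r t s' ->
  t <= size l * search_cost alg /\ shrinks s s'.
Proof.
elim: l s r t s' => [|a l IHl] s r t s' s_valid /=; first by move=> _ _ [_ -> ->].
move=> /andP[a_l l_uniq] l_i [x [t1 [s1 [t2 [m1 m2 ->]]]]].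
have [le1 sh1 keep] := revise_value_spec s_valid (l_i _ (mem_head _ _)) m1.
have s1_valid := preorder_valid shrinks_preorder sh1 s_valid.
have [|le2 sh2] := IHl _ _ _ _ s1_valid l_uniq _ m2.
  move=> b b_l; apply: keep; last by apply: l_i; rewrite inE b_l orbT.
  by apply: contraNneq a_l => <-.
by split; [rewrite mulSn leq_add | exact: (preorder_trans shrinks_preorder sh1 sh2)].
Qed.

Lemma within_process alg j :
  within shrinks (process (P := P) alg j) (#|con P j| * (d * search_cost alg)).
Proof.
apply: within_all_vars => // i; split=> s r t s' s_valid.
move=> [x0 [t0 [s0 [u0 [[-> -> ->] m0 ->]]]]].
move: m0 => [x1 [t1 [s1 [u1 [m1 m2 ->]]]]].
move: m2 => [x2 [t2 [s2 [u2 [[-> -> ->] [_ -> ->] ->]]]]].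
have [//|le1 sh1] := for_each_revise_value s_valid (uniq_doms i s_valid) _ m1.
split=> //; rewrite add0n !addn0; apply: leq_trans le1 _.
by rewrite leq_mul2r size_doms ?orbT.
Qed.

(** * Potential and amortized cost of an invocation *)

Definition potential (f : var -> nat) : nat := \sum_j #|con P j| * f j.

Lemma leq_potential f g : (forall j, f j <= g j) -> potential f <= potential g.
Proof. by move=> le_fg; apply: leq_sum => j _; rewrite leq_mul2l le_fg orbT. Qed.

(** Leaving the queue costs [j] one unit of weight; the factor [#|con P j|] matches the number of
    neighbours that [process] then revises. *)
Lemma potential_dequeue s j :
  j \in queue s ->
  potential (weight s) =
    #|con P j| + potential (weight (with_queue s (queue s :\ j))).
Proof.
move=> j_q; rewrite /potential (bigD1 j) //= [in RHS](bigD1 j) //= addnA.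
congr (_ + _); first by rewrite /weight /= !inE eqxx j_q /= add0n -mulnS.
by apply: eq_bigr => i i_j; rewrite /weight /= !inE i_j.
Qed.

(** The potential released by a dequeuing, times [d * search_cost alg], is exactly the bound of
    [within_process] on the iteration it starts. *)
Lemma reaches_spec alg s0 st t s :
  valid s0 -> reaches alg s0 st t s ->
  valid s /\ t + d * search_cost alg * potential (weight s)
             <= d * search_cost alg * potential (weight s0).
Proof.
move=> s0_valid; elim=> {st t s} [|t s j r t' s' _ [s_valid le_t] j_q m] //.
have dequeue_valid : valid (with_queue s (queue s :\ j)) by [].
have [le_t' sh] := within_run (within_process alg j) dequeue_valid m.
split; first exact: (preorder_valid shrinks_preorder sh dequeue_valid).
have le_p := leq_mul (leqnn (d * search_cost alg))
  (leq_potential (fun i => (sh i).2)).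
move: le_t le_t' le_p; rewrite (potential_dequeue j_q) mulnDr mulnCA.
lia.
Qed.

(** * Assignments and branches *)

Lemma assign_valid s x a : a \in doms s x -> valid s -> valid (assign s x a).
Proof.
move=> a_x s_valid j /=; case: (eqVneq j x) => [->|_]; last exact: s_valid.
by apply: subseq_trans (s_valid x); rewrite sub1seq.
Qed.

(** The queue becomes [[set x]], so only [x] can gain a unit; its domain contains [a], hence is no
    smaller than the new singleton. *)
Lemma weight_assign s x a j :
  a \in doms s x -> weight (assign s x a) j <= (j == x) + weight s j.
Proof.
rewrite /weight /= inE; case: (eqVneq j x) => [->|_] /=; last by lia.
by case: (doms s x) => //= b l _; lia.
Qed.

Lemma search_state_valid alg s : search_state alg s -> valid s.
Proof.
elim=> {s} [i|s x a t s' _ s_valid a_x|s D _ _ D_sub] //.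
by case=> [[]|] /(reaches_spec (assign_valid a_x s_valid)) [].
Qed.

(** The summand [j \notin A] is a credit for the one assignment of [j] on the branch, and assigning
    [x] spends it on queueing [x]. With [st] arbitrary, a last invocation that fails or is
    incomplete is covered too. *)
Lemma assign_reaches alg s x a st t s' (A : {set var}) :
  valid s -> a \in doms s x -> x \notin A -> reaches alg (assign s x a) st t s' ->
  valid s' /\
  t + d * search_cost alg * potential (fun j => (j \notin x |: A) + weight s' j)
  <= d * search_cost alg * potential (fun j => (j \notin A) + weight s j).
Proof.
move=> s_valid a_x x_A /(reaches_spec (assign_valid a_x s_valid))[s'_valid le_t].
split=> //; move: le_t; set W := d * _.
have potentialD (B : {set var}) s1 : potential (fun j => (j \notin B) + weight s1 j)
    = potential (fun j => j \notin B) + potential (weight s1).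
  by rewrite /potential -big_split; apply: eq_bigr => j _; rewrite mulnDr.
rewrite !potentialD !mulnDr.
have le_p : potential (fun j => j \notin x |: A) + potential (weight (assign s x a))
    <= potential (fun j => j \notin A) + potential (weight s).
  rewrite -!potentialD; apply: leq_potential => j.
  have := weight_assign j a_x; rewrite !inE.
  case: (eqVneq j x) => [->|_] /=; last by rewrite add0n leq_add2l.
  by rewrite x_A.
have := leq_mul (leqnn W) le_p; rewrite !mulnDr => le_Wp le_t.
by apply: leq_trans le_Wp; rewrite addnCA leq_add2l.
Qed.

Lemma branch_spec alg s0 A t s :
  valid s0 -> branch alg s0 A t s ->
  valid s /\
  t + d * search_cost alg * potential (fun j => (j \notin A) + weight s j)
  <= d * search_cost alg * potential (fun j => 1 + weight s0 j).
Proof.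
move=> s0_valid; elim=> {A t s} [|A t s x a t' s' _ [s_valid le_t] x_A a_x [m _]].
  split=> //; rewrite add0n leq_mul2l leq_potential ?orbT // => j.
  by rewrite inE.
have [s'_valid le_t'] := assign_reaches s_valid a_x x_A m; split=> //.
by apply: leq_trans le_t; rewrite -addnA leq_add2l.
Qed.

(** * Sum of the degrees and the explicit bound for a branch *)

Lemma sum_degrees : \sum_j #|con P j| <= 2 * num_constraints P.
Proof.
pose E := [set p : var * var | (p.1 < p.2) && con P p.1 p.2].
pose swap (p : var * var) := (p.2, p.1).
have -> : \sum_j #|con P j| = #|[set p : var * var | con P p.1 p.2]|.
  under eq_bigr do rewrite -sum1_card.
  rewrite pair_big_dep -sum1_card /=.
  by apply: eq_bigl => p; rewrite inE.
(* Related ordered pairs lie in [E] or in its mirror image; irreflexivity excludes the diagonal. *)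
suff sub : [set p : var * var | con P p.1 p.2] \subset E :|: swap @: E.
  apply: leq_trans (subset_leq_card sub) _; apply: leq_trans (leq_card_setU _ _) _.
  by rewrite mul2n -addnn leq_add2l leq_imset_card.
apply/subsetP=> -[i j]; rewrite !inE /= => c_ij.
case: (ltngtP i j) => [_|lt_ji|/val_inj eq_ij]; first by rewrite c_ij.
  by apply/orP; right; apply/imsetP; exists (j, i); rewrite // inE lt_ji /= con_sym.
by rewrite eq_ij con_irrefl in c_ij.
Qed.

(** The variable [x] and its value [a] witness that [n] and [d] are positive, which later absorbs
    lower-order terms. *)
Lemma branch_checks_bound alg t :
  branch_checks P alg t ->
  [/\ 0 < n, 0 < d &
      t <= d * search_cost alg * (2 * num_constraints P * (d + 2))].
Proof.
move=> [s0 [A [t1 [s [x [a [st [t2 [s' [s0_search br [x_A a_x] m ->]]]]]]]]]].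
have s0_valid := search_state_valid s0_search.
have [s_valid le_t1] := branch_spec s0_valid br.
have [_ le_t2] := assign_reaches s_valid a_x x_A m.
have n_gt0 : 0 < n by case: x {a_x x_A m le_t2} => ? /=; apply: leq_trans.
have d_gt0 : 0 < d.
  by apply: leq_trans (size_doms x s_valid); case: (doms s x) a_x.
split=> //.
(* Per variable: at most [d] values, one unit for a place in the initial queue and one for the
   assignment credit. *)
have le_p : potential (fun j => 1 + weight s0 j) <= 2 * num_constraints P * (d + 2).
  apply: leq_trans (leq_mul sum_degrees (leqnn _)).
  rewrite big_distrl /=; apply: leq_potential => j.
  have := size_doms j s0_valid; rewrite /weight; case: (_ \in _); lia.
apply: leq_trans (leq_mul (leqnn _) le_p); apply: leq_trans le_t1.
by rewrite leq_add2l; apply: leq_trans le_t2; apply: leq_addr.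
Qed.

(** A single invocation is a branch with no completed assignment before it. *)
Lemma node_checks_branch alg t : node_checks P alg t -> branch_checks P alg t.
Proof.
move=> [s [x [a [st [s' [s_search a_x m]]]]]].
exists s, set0, 0, s, x, a, st, t, s'; split=> //; first exact: branch_start.
by rewrite inE.
Qed.

End Within.

(** * Asymptotic bounds *)

Lemma branch_time_lmaxRPC3rm :
  worst_case_bigO (branch_time lmaxRPC3rm) (fun n e d => e * n * d ^ 4).
Proof.
(* The factor 5 of [le_scan] times the factor [2 * 3] of [le_2e]. *)
exists 30 => n e d t [P [<- <- /branch_checks_bound[]]].
rewrite /search_cost /scan_cost.
move: (max_domain_size P) (num_constraints P) => {}d {}e n_gt0 d_gt0 le_t.
have le_scan : 1 + n * (2 + 2 * d) <= 5 * (n * d) by nia.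
have le_2e : 2 * e * (d + 2) <= 2 * e * (3 * d) by rewrite leq_mul2l; lia.
apply: leq_trans le_t _.
apply: leq_trans (leq_mul (leq_mul (leqnn d) (leq_mul (leqnn d) le_scan)) le_2e) _.
by rewrite !expnS expn0; nia.
Qed.

Lemma branch_time_maxRPC3rm :
  worst_case_bigO (branch_time maxRPC3rm) (fun n e d => e * n ^ 2 * d ^ 4).
Proof.
(* The factor 14 of [le_search] times the factor [2 * 3] of [le_2e]. *)
exists 84 => n e d t [P [<- <- /branch_checks_bound[]]].
rewrite /search_cost /scan_cost.
move: (max_domain_size P) (num_constraints P) => {}d {}e n_gt0 d_gt0 le_t.
have le_scan : d * (1 + n * (2 + 2 * d)) <= 5 * (n * d ^ 2).
  have : 1 + n * (2 + 2 * d) <= 5 * (n * d) by nia.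
  by move=> /(leq_mul (leqnn d)) /leq_trans; apply; rewrite !expnS expn0; nia.
(* Here 14 is 5 + 4 + 5: the first scan, the witness searches from residues and the repeated
   scans. *)
have le_search : d * (1 + n * (2 + 2 * d)) +
    n * (2 + 2 * d + d * (1 + n * (2 + 2 * d))) <= 14 * (n ^ 2 * d ^ 2).
  move: le_scan; set c := d * _ => le_scan.
  have le_n : n <= n ^ 2 by rewrite -mulnn leq_pmulr.
  have le_d : 2 + 2 * d <= 4 * d ^ 2 by nia.
  have le_nc : n * (2 + 2 * d + c) <= n * (4 * d ^ 2 + 5 * (n * d ^ 2)).
    by rewrite leq_mul2l leq_add ?orbT.
  by have := leq_mul le_n (leqnn (d ^ 2)); nia.
have le_2e : 2 * e * (d + 2) <= 2 * e * (3 * d) by rewrite leq_mul2l; lia.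
apply: leq_trans le_t _.
apply: leq_trans (leq_mul (leq_mul (leqnn d) le_search) le_2e) _.
by rewrite !expnS expn0; nia.
Qed.

Theorem proposition4 :
  [/\ worst_case_bigO (node_time lmaxRPC3rm) (fun n e d => e * n * d ^ 4),
      worst_case_bigO (branch_time lmaxRPC3rm) (fun n e d => e * n * d ^ 4),
      worst_case_bigO (node_time maxRPC3rm) (fun n e d => e * n ^ 2 * d ^ 4) &
      worst_case_bigO (branch_time maxRPC3rm) (fun n e d => e * n ^ 2 * d ^ 4)].
Proof.
have node_of_branch alg f :
    worst_case_bigO (branch_time alg) f -> worst_case_bigO (node_time alg) f.
  move=> [K HK]; exists K => n e d t [P [eP dP Pt]]; apply: HK.
  by exists P; split=> //; apply: node_checks_branch.
split.
- exact: node_of_branch branch_time_lmaxRPC3rm.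
- exact: branch_time_lmaxRPC3rm.
- exact: node_of_branch branch_time_maxRPC3rm.
- exact: branch_time_maxRPC3rm.
Qed.
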